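(* Any quantum distributed algorithm (in the quantum routing model) solving Breadth-First Search with bounded error must send $\Omega(\sqrt{mn})$ quantum messages in the worst case. That is, for all positive integers $N$ and $d\le N-1$ there is a network with $n=\Theta(N)$ nodes and $m=\Theta(Nd)$ edges and a root $r$ such that, for a worst-case port numbering of this network, the message complexity of the algorithm is $\Omega(\sqrt{mn})$.
   Context: Quantum routing model. The network is an undirected connected graph $G=(V,E)$, $n=|V|$, $m=|E|$. Each node $u$ has $\deg(u)$ numbered ports, each connected to one neighbour; nodes have no identities and initially have only local knowledge (they do not know who is behind a port). For each port $p=(u,v)$, node $u$ holds an emission register $u\to v$ and a reception register $u\gets v$, each holding either an $O(\log n)$-qubit message or the empty symbol $\bot$. All nodes start simultaneously, run the same algorithm, have private randomness, and know a polynomial upper bound on $n$. Computation proceeds in synchronous rounds. In each round: (1) every node applies the same local unitary to its local data, local memory and emission/reception registers; (2) the operator $\mathsf{Send}$ is applied, which for every ordered pair $(u,v)$ of neighbours swaps the contents of $u\to v$ (held by $u$) and $v\gets u$ (held by $v$). Outputs are obtained by measuring local registers. In particular a node may prepare a single message in a superposition over its ports. Message complexity. A round has message complexity $M$ if the global state of the network is a superposition of (deterministic) configurations in each of which at most $M$ non-empty messages are sent. The message complexity of an algorithm is the sum of the message complexities of its rounds. BFS problem. Given a distinguished node $r\in V$ (which knows it is distinguished), the goal is for each node to output the edges (ports) of a breadth-first search tree rooted at $r$ that are incident on itself. ''Bounded error'' means error probability smaller than some constant, usually $1/3$. *)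

(* Defs.v *)
From mathcomp Require Import all_boot all_order all_algebra.
From mathcomp Require Import boolp reals complex.

Set Implicit Arguments.
Unset Strict Implicit.
Unset Printing Implicit Defensive.

Import GRing.Theory Num.Theory.
Local Open Scope ring_scope.

Record network := Network {
  node :> finType;
  adj : rel node;
  adj_sym : symmetric adj;
  adj_irr : irreflexive adj;
  adj_connected : forall u v, connect adj u v
}.

Section Network.
Variable G : network.

Definition deg (u : G) : nat := #|[pred v | adj u v]|.

Definition edges : {set {set G}} :=
  [set [set a.1; a.2] | a : G * G & adj a.1 a.2].

Definition arc := {a : G * G | adj a.1 a.2}.

Definition rev_arc (a : arc) : arc :=
  exist (fun a : G * G => adj a.1 a.2) ((val a).2, (val a).1)
    (etrans (adj_sym (val a).2 (val a).1) (valP a)).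

(* [port u p] is the neighbour behind port [p] of [u]. Since [u] has exactly
   [deg u] neighbours, injectivity makes [port u] a bijection onto them. *)
Record port_numbering := PortNumbering {
  port : forall u : G, 'I_(deg u) -> G;
  port_adj : forall u p, adj u (@port u p);
  port_inj : forall u, injective (@port u)
}.

Definition port_arc (pn : port_numbering) (u : G) (p : 'I_(deg u)) : arc :=
  exist (fun a : G * G => adj a.1 a.2) (u, port pn p) (port_adj pn p).

Definition acyclic (T : rel G) : Prop :=
  forall c : seq G, (2 < size c)%N -> cycle T c -> ~~ uniq c.

Definition bfs_tree (r : G) (T : rel G) : Prop :=
  [/\ symmetric T,
      subrel T (@adj G),
      forall u v, connect T u v,
      acyclic T
    & forall v, exists p : seq G,
        [/\ path T r p, last r p = v
          & forall q : seq G, path (@adj G) r q -> last r q = v ->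
              (size p <= size q)%N]].

(* Both endpoints of an edge of the tree must output it. *)
Definition bfs_output (pn : port_numbering) (r : G)
    (out : forall u : G, {set 'I_(deg u)}) : Prop :=
  exists2 T : rel G, bfs_tree r T
    & forall (u : G) (p : 'I_(deg u)), (p \in out u) = T u (port pn p).

End Network.

(* [None] is the empty symbol; the basis of a [w]-qubit message is indexed by
   [w]-bit strings. *)
Definition register (w : nat) : finType := option (w.-tuple bool).

(* Computational basis of everything held by a node of degree [d]: its memory,
   its emission registers and its reception registers, indexed by ports. *)
Definition local_basis (M : finType) (w d : nat) : finType :=
  (M * {ffun 'I_d -> register w} * {ffun 'I_d -> register w})%type.

(* The argument [k] is the upper bound on the number of nodes known to all the
   nodes; the boolean tells a node whether it is the root. A node has no other
   initial information than [k], this boolean, its degree and its own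
   [rand_bits k] uniform private random bits. Column [x] of a local unitary,
   in the basis enumerated by [enum_rank], is the image of [x]. *)
Record algorithm (R : realType) := Algorithm {
  mem_space : nat -> finType;
  msg_qubits : nat -> nat;
  rand_bits : nat -> nat;
  rounds : nat -> nat;
  init_mem : forall (k : nat) (is_root : bool) (d : nat),
    (rand_bits k).-tuple bool -> mem_space k;
  local_op : forall (k t : nat) (is_root : bool) (d : nat),
    'M[R[i]]_#|local_basis (mem_space k) (msg_qubits k) d|;
  local_op_unitary : forall (k t : nat) (is_root : bool) (d : nat),
    local_op k t is_root d \is unitarymx;
  output : forall (k : nat) (is_root : bool) (d : nat),
    local_basis (mem_space k) (msg_qubits k) d -> {set 'I_d}
}.

Arguments init_mem {R} A k is_root d _ : rename.
Arguments local_op {R} A k t is_root d : rename.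
Arguments output {R} A k is_root d _ : rename.

Section Run.
Variables (R : realType) (A : algorithm R) (k : nat).
Variables (G : network) (pn : port_numbering G) (r : G).

Local Notation msg := (register (msg_qubits A k)).

(* Memory of each node, and contents of the registers u -> v and u <- v for
   each ordered pair (u, v) of neighbours. *)
Definition config : finType :=
  ({ffun G -> mem_space A k} * {ffun arc G -> msg} * {ffun arc G -> msg})%type.

Definition memory (c : config) := c.1.1.
Definition emission (c : config) := c.1.2.
Definition reception (c : config) := c.2.

Definition local_view (c : config) (u : G) :
    local_basis (mem_space A k) (msg_qubits A k) (deg u) :=
  (memory c u, [ffun p => emission c (port_arc pn p)],
   [ffun p => reception c (port_arc pn p)]).

Definition seeds := {ffun G -> (rand_bits A k).-tuple bool}.

Definition init_config (s : seeds) : config :=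
  ([ffun u => init_mem A k (u == r) (deg u) (s u)], [ffun=> None], [ffun=> None]).

Definition state := {ffun config -> R[i]}.

Definition entry (t : nat) (u : G)
    (y x : local_basis (mem_space A k) (msg_qubits A k) (deg u)) : R[i] :=
  local_op A k t (u == r) (deg u) (enum_rank y) (enum_rank x).

(* Tensor product of the local unitaries of all the nodes. *)
Definition apply_local (t : nat) (psi : state) : state :=
  [ffun c' : config =>
    \sum_(c : config)
      (\prod_(u : G) entry t (local_view c' u) (local_view c u)) * psi c].

Definition send_config (c : config) : config :=
  (memory c, [ffun a => reception c (rev_arc a)],
   [ffun a => emission c (rev_arc a)]).

(* [send_config] is an involution, so the amplitude of [c] after Send is the
   amplitude of [send_config c] before it. *)
Definition apply_send (psi : state) : state :=
  [ffun c => psi (send_config c)].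

Fixpoint state_after (s : seeds) (t : nat) : state :=
  if t is t'.+1 then apply_send (apply_local t' (state_after s t'))
  else [ffun c => (c == init_config s)%:R].

(* Non-empty contents exchanged when Send is applied to [c]. Send is a swap, so
   a non-empty reception register of [u] is delivered to the neighbour of [u]
   just as a non-empty emission register is; if it were not counted, nodes
   could communicate for free by writing into their reception registers. *)
Definition num_messages (c : config) : nat :=
  (#|[pred a | emission c a != None]| + #|[pred a | reception c a != None]|)%N.

Definition round_messages (t : nat) : nat :=
  \max_(s : seeds)
    \max_(c : config | apply_local t (state_after s t) c != 0%R) num_messages c.

Definition message_complexity : nat :=
  (\sum_(t < rounds A k) round_messages t)%N.

Definition prob (psi : state) (c : config) : R :=
  complex.Re (psi c) ^+ 2 + complex.Im (psi c) ^+ 2.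

Definition config_output (c : config) (u : G) : {set 'I_(deg u)} :=
  output A k (u == r) (deg u) (local_view c u).

(* Probability that measuring all the local registers after the last round
   yields a correct output, averaged over the private random bits. *)
Definition success_prob : R :=
  (\sum_(s : seeds)
     \sum_(c : config | `[< bfs_output pn r (config_output c) >])
       prob (state_after s (rounds A k)) c) / #|{: seeds}|%:R.

End Run.

(* [known n] is the bound given to the nodes of every [n]-node network. *)
Definition polynomial_upper_bound (known : nat -> nat) : Prop :=
  (forall n, n <= known n)%N /\
  exists a b : nat, forall n, (0 < n -> known n <= a * n ^ b)%N.

Definition log_size_messages (R : realType) (A : algorithm R)
    (known : nat -> nat) : Prop :=
  exists a : nat, forall n : nat,
    (1 < n -> msg_qubits A (known n) <= a * trunc_log 2 n)%N.

Definition solves_bfs (R : realType) (A : algorithm R) (known : nat -> nat)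
    (eps : R) : Prop :=
  forall (G : network) (pn : port_numbering G) (r : G),
    1 - eps <= success_prob A (known #|G|) pn r.

(* Main.v *)
(* The hard network: a root joined to an upper layer, a d-regular graph inside
   the upper and one inside a lower layer, and a perfect matching of spokes between
   the layers. Every BFS tree contains all spokes and no edge inside the lower
   layer. Only the port numbering varies; a move re-plugs the two ends of one
   spoke, exchanging its upper port with a port leading to a sibling, and its
   lower port likewise. The correct outputs before and after are disjoint.

   Ambainis' weighted adversary: runs on two numberings differing by a move are
   compared in a common basis, indexed by the ports, in which the local unitaries
   agree and Send permutes the ports by an involution. Their overlap only drops
   on configurations with a message on a port where the involutions differ. A
   port holding a spoke is affected by at most d^2 moves, any other one by at
   most 4d, and no drop pairs two ports both holding spokes, so weighting by
   d^(-1/2) and d^(1/2) makes a message cost O(d^(3/2)). As there are of the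
   order of N d^2 moves, some numbering costs of the order of N sqrt d. *)

Require Import Defs.
From mathcomp Require Import all_boot all_order all_algebra.
From mathcomp Require Import all_fingroup.
From mathcomp Require Import boolp reals complex.
From mathcomp Require Import zify lra ring.

Set Implicit Arguments.
Unset Strict Implicit.
Unset Printing Implicit Defensive.

Import Order.TTheory GRing.Theory Num.Theory.
Local Open Scope ring_scope.

Local Notation arc := Defs.arc.

(** Distributivity with one summation type per factor: nodes of different degrees have local bases
    of different types. *)
Lemma prod_sum_fprod (C : comPzSemiRingType) (I : finType) (L : I -> finType)
    (F : forall i, L i -> C) :
  \sum_(f : fprod L) \prod_i F i (f i) = \prod_i \sum_(x : L i) F i x.
Proof.
pose P i : {ffun L i -> C} := [ffun x => F i x].
transitivity (\sum_(f : fprod L) \prod_(i in I) P i (f i)).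
  by apply: eq_bigr => f _; apply: eq_bigr => i _; rewrite ffunE.
rewrite (@big_fprod C 0 1 *%R +%R I L P).
transitivity (\prod_i \sum_(j in tagged_with L i) untag 0 (P i) j).
  by rewrite bigA_distr_big_dep; apply: eq_bigl.
apply: eq_bigr => i _; rewrite -(big_tag (fun i => P i)).
by apply: eq_bigr => x _; rewrite ffunE.
Qed.

(** * Ports and local unitaries *)

Section Ports.
Variables (G : network) (pn : port_numbering G).

Lemma port_surj (u v : G) : adj u v -> exists p : 'I_(deg u), port pn p == v.
Proof.
move=> uv; pose P := [set port pn p | p : 'I_(deg u)].
have sP : P \subset [set v | adj u v].
  by apply/subsetP=> w /imsetP[p _ ->]; rewrite inE; exact: port_adj.
have /eqP EP : P == [set v | adj u v].
  rewrite eqEcard sP (card_imset _ (@port_inj _ pn u)).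
  by rewrite cardsE card_ord; exact: leqnn.
have : v \in P by rewrite EP inE.
by case/imsetP=> p _ ->; exists p; rewrite eqxx.
Qed.

Definition port_of (a : arc G) : 'I_(deg (val a).1) :=
  xchoose (port_surj (valP a)).

Lemma port_arc_inj (u : G) : injective (@port_arc G pn u).
Proof. by move=> p q [] /port_inj. Qed.

Lemma port_ofK (a : arc G) : port_arc pn (port_of a) = a.
Proof.
apply: val_inj; rewrite /= (eqP (xchooseP (port_surj (valP a)))).
by rewrite -surjective_pairing.
Qed.

Lemma port_arcK (u : G) (p : 'I_(deg u)) : port_of (port_arc pn p) = p.
Proof. exact: port_arc_inj (port_ofK (port_arc pn p)). Qed.

End Ports.

Section InnerProduct.
Variables (R : realType) (T : finType).
Implicit Types f g : {ffun T -> R[i]}.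

(** The real part of the Hermitian product: unitaries preserve it, it is the squared norm on the
    diagonal, and it keeps all estimates among real numbers. *)
Definition dot f g : R := \sum_c complex.Re ((f c)^* * g c).

Lemma dotE f g :
  dot f g = \sum_c (complex.Re (f c) * complex.Re (g c)
                    + complex.Im (f c) * complex.Im (g c)).
Proof.
by apply: eq_bigr => c _; case: (f c) (g c) => [a b] [a' b'] /=; rewrite mulNr opprK.
Qed.

Lemma dot_Re_sum f g : dot f g = complex.Re (\sum_c (f c)^* * g c).
Proof.
rewrite /dot; elim/big_rec2: _ => // c y1 y2 _ ->.
by case: ((f c)^* * g c); case: y1.
Qed.

End InnerProduct.

(** * Local unitaries preserve inner products *)

Section LocalStep.
Variables (R : realType) (A : algorithm R) (k : nat).
Variables (G : network) (pn : port_numbering G) (r : G).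

Local Notation config := (config A k G).
Local Notation L u := (local_basis (mem_space A k) (msg_qubits A k) (deg u)).
Local Notation views := (fprod (fun u : G => L u)).

(** Each arc sits at exactly one port of its source, so a configuration amounts to an independent
    choice of a view for every node. *)
Definition view_all (c : config) : views := [fprod u => local_view pn c u].

Definition of_views (f : views) : config :=
  ([ffun u => (f u).1.1],
   [ffun a => (f (val a).1).1.2 (port_of pn a)],
   [ffun a => (f (val a).1).2 (port_of pn a)]).

Lemma view_allK : cancel view_all of_views.
Proof.
move=> [[m e] c]; rewrite /of_views; congr (_, _, _); apply/ffunP=> x.
- by rewrite ffunE fprodE.
- by rewrite ffunE fprodE /= ffunE port_ofK.
- by rewrite ffunE fprodE /= ffunE port_ofK.
Qed.

Lemma of_viewsK : cancel of_views view_all.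
Proof.
move=> f; apply/fprodP=> u; rewrite fprodE /local_view /of_views /memory /=.
rewrite ffunE; case E: (f u) => [[m e] c] /=; congr (_, _, _); apply/ffunP=> p;
 by rewrite !ffunE /= port_arcK E.
Qed.

Lemma local_view_inj (c1 c2 : config) :
  (forall u, local_view pn c1 u = local_view pn c2 u) -> c1 = c2.
Proof.
move=> E; apply: (can_inj view_allK); apply/fprodP=> u.
by rewrite !fprodE.
Qed.

Lemma sum_local_view (F : forall u, L u -> R[i]) :
  \sum_(c : config) \prod_u F u (local_view pn c u) = \prod_u \sum_x F u x.
Proof.
rewrite -prod_sum_fprod (reindex view_all); last first.
  by exists of_views => x _; rewrite ?view_allK ?of_viewsK.
by apply: eq_bigr => c _; apply: eq_bigr => u _; rewrite fprodE.
Qed.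

Lemma entry_orthonormal (t : nat) (u : G) (x1 x2 : L u) :
  \sum_y (entry r t y x1)^* * entry r t y x2 = (x1 == x2)%:R.
Proof.
set M := local_op A k t (u == r) (deg u).
(* Unitarity gives orthonormal rows; [mulmx1C] reverses the product and so gives orthonormal
   columns. *)
have /unitarymxP/mulmx1C/matrixP E : M \is unitarymx.
  exact: local_op_unitary.
have -> : (x1 == x2)%:R = (1%:M : 'M[R[i]]_#|L u|) (enum_rank x1) (enum_rank x2).
  by rewrite mxE (inj_eq enum_rank_inj).
rewrite -E !mxE (reindex (@enum_rank (L u))); last first.
  by apply: onW_bij; exact: enum_rank_bij.
by apply: eq_bigr => y _; rewrite !mxE.
Qed.

(** The columns of a tensor product of unitaries are orthonormal: their inner products factor over
    the nodes, and distinct configurations differ in some view, which contributes a zero factor. *)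
Lemma apply_local_dot (t : nat) (f g : state A k G) :
  dot (apply_local pn r t f) (apply_local pn r t g) = dot f g.
Proof.
rewrite !dot_Re_sum; congr complex.Re.
pose E (c' c : config) : R[i] := \prod_u entry r t (local_view pn c' u) (local_view pn c u).
transitivity (\sum_c1 \sum_c2 ((f c1)^* * g c2) * \sum_(c' : config) (E c' c1)^* * E c' c2).
  transitivity (\sum_(c' : config) \sum_c1 \sum_c2 ((f c1)^* * g c2) * ((E c' c1)^* * E c' c2)).
    apply: eq_bigr => c' _; rewrite !ffunE rmorph_sum big_distrlr /=.
    apply: eq_bigr => c1 _; apply: eq_bigr => c2 _; rewrite rmorphM.
    rewrite -/(E c' c1) -/(E c' c2).
    by rewrite mulrACA mulrC.
  rewrite exchange_big; apply: eq_bigr => c1 _ /=.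
  rewrite exchange_big; apply: eq_bigr => c2 _ /=.
  by rewrite mulr_sumr.
apply: eq_bigr => c1 _.
have EE c2 : \sum_(c' : config) (E c' c1)^* * E c' c2 = (c1 == c2)%:R.
  pose F u (y : L u) : R[i] :=
    (entry r t y (local_view pn c1 u))^* * entry r t y (local_view pn c2 u).
  transitivity (\sum_(c' : config) \prod_u F u (local_view pn c' u)).
    by apply: eq_bigr => c' _; rewrite /E rmorph_prod -big_split.
  rewrite sum_local_view.
  under eq_bigr do rewrite entry_orthonormal.
  have [->|ne] := eqVneq c1 c2; first by apply: big1 => u _; rewrite eqxx.
  have [u Du] : exists u, local_view pn c1 u != local_view pn c2 u.
    apply/existsP; apply: contraR ne; rewrite negb_exists => /forallP h.
    by apply/eqP/local_view_inj => u; apply/eqP; have := h u; rewrite negbK.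
  by rewrite (bigD1 u) //= (negbTE Du) mul0r.
rewrite (bigD1 c1) //= EE eqxx mulr1 big1 ?addr0 // => c2 ne.
by rewrite EE eq_sym (negbTE ne) mulr0.
Qed.

End LocalStep.

(** * Runs on different port numberings in a common basis *)

Section Relabelling.
Variables (G : network) (pn0 : port_numbering G).

Definition source_preserving (rho : {perm arc G}) :=
  [forall a, (val (rho a)).1 == (val a).1].

(* [x : relabelling] turns the numbering [pn0] into one where port [p] of [u] holds
   [x (port_arc pn0 p)]; in the basis common to all numberings the arc
   [port_arc pn0 p] stands for port [p] of [u], whatever is plugged into it. *)
Definition relabelling := {rho : {perm arc G} | source_preserving rho}.

Lemma relabelling_source (x : relabelling) (a : arc G) :
  (val (val x a)).1 = (val a).1.
Proof. exact/eqP/(forallP (valP x) a). Qed.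

Section Numbering.
Variable x : relabelling.

Lemma relabel_adj (u : G) (p : 'I_(deg u)) :
  adj u (val (val x (port_arc pn0 p))).2.
Proof.
by have := valP (val x (port_arc pn0 p)); rewrite relabelling_source.
Qed.

Lemma relabel_arcE (u : G) (p : 'I_(deg u)) :
  val (val x (port_arc pn0 p)) = (u, (val (val x (port_arc pn0 p))).2).
Proof.
by rewrite [LHS]surjective_pairing relabelling_source.
Qed.

Lemma relabel_inj (u : G) :
  injective (fun p : 'I_(deg u) => (val (val x (port_arc pn0 p))).2).
Proof.
move=> p q E; apply: (@port_arc_inj G pn0 u); apply: (@perm_inj _ (val x)).
by apply: val_inj; rewrite [LHS]relabel_arcE [RHS]relabel_arcE E.
Qed.

Definition relabel : port_numbering G := PortNumbering relabel_adj relabel_inj.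

Lemma port_arc_relabel (u : G) (p : 'I_(deg u)) :
  port_arc relabel p = val x (port_arc pn0 p).
Proof. by apply: val_inj; rewrite [RHS]relabel_arcE. Qed.

End Numbering.
End Relabelling.

Lemma rev_arcK (G : network) : involutive (@rev_arc G).
Proof. by move=> a; apply: val_inj; rewrite /= -surjective_pairing. Qed.

(** Weighted AM-GM: once [k2] is lowered to the inverse of [k1], the difference of the sides is a
    positive multiple of a sum of two squares. The sign [s] covers both halves of the absolute
    value. *)
Lemma mulr_ge1_amgm (R : realType) (k1 k2 : R) (z w : R[i]) :
  0 < k1 -> 1 <= k1 * k2 ->
  `|complex.Re (z^* * w)| <=
    (k1 * (complex.Re z ^+ 2 + complex.Im z ^+ 2)
     + k2 * (complex.Re w ^+ 2 + complex.Im w ^+ 2)) / 2.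
Proof.
case: z w => [a b] [c d] /= k1_gt0 k12.
have k2E : k1^-1 <= k2 by rewrite -(ler_pM2l k1_gt0) divff ?gt_eqF.
have H (s : R) : s ^+ 2 = 1 ->
    s * (a * c - (- b) * d) <= (k1 * (a ^+ 2 + b ^+ 2) + k2 * (c ^+ 2 + d ^+ 2)) / 2.
  move=> s2.
  have le1 : (k1 * (a ^+ 2 + b ^+ 2) + k1^-1 * (c ^+ 2 + d ^+ 2)) / 2 <=
             (k1 * (a ^+ 2 + b ^+ 2) + k2 * (c ^+ 2 + d ^+ 2)) / 2.
    by rewrite ler_pM2r ?invr_gt0 // lerD2l ler_wpM2r // addr_ge0 ?sqr_ge0.
  apply: le_trans le1; rewrite -subr_ge0.
  rewrite [X in 0 <= X](_ : _ = k1^-1 / 2 * ((s * k1 * a - c) ^+ 2 + (s * k1 * b - d) ^+ 2)).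
    apply: mulr_ge0; last by rewrite addr_ge0 ?sqr_ge0.
    by rewrite divr_ge0 // invr_ge0 ltW.
  rewrite !sqrrB !exprMn s2; field; exact: lt0r_neq0.
rewrite ler_norml; apply/andP; split.
  by have := H (-1); rewrite sqrrN expr1n => /(_ erefl); lra.
by have := H 1 (expr1n _ 2); lra.
Qed.

(** * Loss of overlap when two runs exchange messages along different wirings *)

Section Swap.
Variables (R : realType) (A : algorithm R) (k : nat) (G : network).
Local Notation config := (config A k G).
Implicit Types (p : arc G -> arc G) (c : config).

Definition occupied c (a : arc G) := (emission c a != None) || (reception c a != None).

(** Send when port [a] is wired to port [p a]; with [rev_arc] for [p] it is [send_config]. *)
Definition swap_along p c : config :=
  (memory c, [ffun a => reception c (p a)], [ffun a => emission c (p a)]).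

Lemma swap_alongK p : involutive p -> involutive (swap_along p).
Proof.
move=> pK [[m e] c]; congr (_, _, _); apply/ffunP=> a;
by rewrite ffunE /= ffunE /= pK.
Qed.

Lemma occupied_swap p c a : occupied (swap_along p c) a = occupied c (p a).
Proof. by rewrite /occupied !ffunE orbC. Qed.

Lemma sum_occupied c : (\sum_a occupied c a <= num_messages c)%N.
Proof.
have E (P : pred (arc G)) : (#|[pred a | P a]| = \sum_a P a)%N.
  by rewrite -sum1_card big_mkcond; apply: eq_bigr => a _; rewrite inE; case: (P a).
rewrite /num_messages !E -big_split /=.
apply: leq_sum => a _; rewrite /occupied.
by case: (emission c a != None); case: (reception c a != None).
Qed.

Definition occupation (f : state A k G) (a : arc G) : R :=
  \sum_(c | occupied c a) prob f c.

Lemma prob_ge0 (f : state A k G) c : 0 <= prob f c.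
Proof. by rewrite addr_ge0 ?sqr_ge0. Qed.

Lemma occupation_ge0 (f : state A k G) a : 0 <= occupation f a.
Proof. by apply: sumr_ge0 => c _; exact: prob_ge0. Qed.

Lemma dot_prob (f : state A k G) : dot f f = \sum_c prob f c.
Proof. by rewrite dotE; apply: eq_bigr => c _; rewrite /prob !expr2. Qed.

(** The left side is the expected number of occupied arcs, and no configuration of non-zero
    amplitude has more than [M] of them. *)
Lemma sum_occupation (f : state A k G) (M : nat) :
  dot f f = 1 -> (forall c, f c != 0 -> (num_messages c <= M)%N) ->
  \sum_a occupation f a <= M%:R.
Proof.
move=> f1 fM.
rewrite /occupation (exchange_big_dep xpredT) //.
apply: (@le_trans _ _ (\sum_c prob f c * M%:R)); last first.
  by rewrite -mulr_suml -dot_prob f1 mul1r.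
apply: ler_sum => c _; rewrite sumr_const -[X in X <= _]mulr_natr.
have [f0|f0] := eqVneq (f c) 0.
  by rewrite /prob f0 expr2 mul0r addr0 !mul0r.
apply: ler_wpM2l; first exact: prob_ge0.
rewrite ler_nat; apply: leq_trans (fM c f0); apply: leq_trans (sum_occupied c).
by rewrite -sum1_card big_mkcond leq_sum.
Qed.

Section Pair.
Variables (px py : arc G -> arc G) (kx ky : arc G -> R).
Hypotheses (pxK : involutive px) (pyK : involutive py).
Hypotheses (kx_gt0 : forall a, 0 < kx a) (ky_gt0 : forall a, 0 < ky a).
Hypothesis kxy : forall a, px a != py a -> 1 <= kx a * ky a.
Hypothesis kxy' : forall a, px a != py a -> 1 <= kx a * ky (py (px a)).

(** Swapping along [px] and then along [py] carries the content of [a] to [tau a]. *)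
Let tau a := py (px a).
Let sigma c := swap_along py (swap_along px c).

Lemma moved_px a : (px (px a) != py (px a)) = (px a != py a).
Proof.
rewrite pxK; congr (~~ _); apply/eqP/eqP => E.
  by rewrite [in RHS]E pyK.
by rewrite E pyK.
Qed.

Lemma moved_py a : (px (py a) != py (py a)) = (px a != py a).
Proof.
rewrite pyK; congr (~~ _); apply/eqP/eqP => E.
  by rewrite -[in LHS]E pxK.
by rewrite -E pxK.
Qed.

(** The ports where [px] and [py] differ are stable under both maps, so when they are empty the two
    swaps act alike on [c]. *)
Lemma sigma_fix c : (forall a, px a != py a -> ~~ occupied c a) -> sigma c = c.
Proof.
move=> h; rewrite /sigma -[RHS](swap_alongK pyK); congr swap_along.
congr (_, _, _); apply/ffunP=> a; rewrite !ffunE.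
- have [-> //|ne] := eqVneq (px a) (py a).
  have := h (px a); rewrite moved_px ne => /(_ isT).
  have := h (py a); rewrite moved_py ne => /(_ isT).
  by rewrite /occupied !negb_or !negbK => /andP[_ /eqP->] /andP[_ /eqP->].
- have [-> //|ne] := eqVneq (px a) (py a).
  have := h (px a); rewrite moved_px ne => /(_ isT).
  have := h (py a); rewrite moved_py ne => /(_ isT).
  by rewrite /occupied !negb_or !negbK => /andP[/eqP-> _] /andP[/eqP-> _].
Qed.

Lemma occupied_sigma c a : occupied (sigma c) (tau a) = occupied c a.
Proof. by rewrite !occupied_swap /tau pyK pxK. Qed.

Lemma sigma_bij : bijective sigma.
Proof.
exists (fun c => swap_along px (swap_along py c)) => c;
by rewrite /sigma !swap_alongK.
Qed.

Lemma tau_bij : bijective tau.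
Proof. by exists (fun a => px (py a)) => a; rewrite /tau ?pyK ?pxK ?pyK. Qed.

(** A change of variables makes the second product pair [f c] with [g (sigma c)]. If no port of
    disagreement is occupied in [c], the two terms at [c] cancel; otherwise each is bounded by
    weighted AM-GM at one such port. *)
Lemma swap_along_dot (f g : state A k G) :
  dot f g - dot [ffun c => f (swap_along px c)] [ffun c => g (swap_along py c)]
  <= \sum_(a | px a != py a) (kx a * occupation f a + ky a * occupation g a).
Proof.
have -> : dot [ffun c => f (swap_along px c)] [ffun c => g (swap_along py c)]
          = \sum_c complex.Re ((f c)^* * g (sigma c)).
  rewrite /dot (reindex (swap_along px)); last first.
    by apply: onW_bij; exists (swap_along px); exact: swap_alongK.
  by apply: eq_bigr => c _; rewrite !ffunE swap_alongK.
rewrite /dot -sumrB.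
(* Sum of the AM-GM bounds for [f c] with [g c] and for [f c] with [g (sigma c)]; the second uses
   the weight at [tau a], the port where [sigma c] is occupied. *)
pose B c a : R := kx a * prob f c
  + (ky a * prob g c + ky (tau a) * prob g (sigma c)) / 2.
have B_ge0 c a : 0 <= B c a.
  by rewrite /B addr_ge0 ?divr_ge0 ?addr_ge0 ?mulr_ge0 ?prob_ge0 ?ltW.
apply: (@le_trans _ _ (\sum_c \sum_(a | (px a != py a) && occupied c a) B c a)).
  apply: ler_sum => c _.
  have [a /andP[Da oa]|none] := pickP (fun a => (px a != py a) && occupied c a).
    rewrite (bigD1 a) ?Da ?oa //= -[X in X <= _]addr0 lerD ?sumr_ge0 //.
    have := mulr_ge1_amgm (f c) (g c) (kx_gt0 a) (kxy Da).
    have := mulr_ge1_amgm (f c) (g (sigma c)) (kx_gt0 a) (kxy' Da).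
    rewrite -/(tau a) -/(prob f c) -/(prob g c) -/(prob g (sigma c)) /B.
    by rewrite !ler_norml => /andP[h1 h2] /andP[h3 h4]; lra.
  rewrite sigma_fix ?subrr ?sumr_ge0 // => a Da.
  by have := none a; rewrite Da /= => ->.
rewrite (exchange_big_dep (fun a => px a != py a)) /=; last by move=> c a _ /andP[].
have E a : \sum_(c | occupied c a) prob g (sigma c) = occupation g (tau a).
  rewrite /occupation [RHS](reindex sigma); last exact/onW_bij/sigma_bij.
  by apply: eq_bigl => c; rewrite occupied_sigma.
have S a : \sum_(c | occupied c a) B c a = kx a * occupation f a
    + (ky a * occupation g a + ky (tau a) * occupation g (tau a)) / 2.
  by rewrite -E /occupation !mulr_sumr -big_split mulr_suml -big_split.
under eq_bigr => a Da do rewrite (eq_bigl (fun c => occupied c a)) ?S // ?Da //.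
rewrite !big_split /= lerD2l -mulr_suml big_split /=.
(* [tau] permutes the ports of disagreement, so the two halves weighted by [ky] have equal sums. *)
rewrite [X in (_ + X) / 2](_ : _ = \sum_(a | px a != py a) ky a * occupation g a).
  by lra.
rewrite [RHS](reindex tau); last exact/onW_bij/tau_bij.
by apply: eq_bigl => a; rewrite /tau moved_py moved_px.
Qed.

End Pair.
End Swap.

(** * Runs transported to the reference basis *)

Section ReferenceRun.
Variables (R : realType) (A : algorithm R) (k : nat).
Variables (G : network) (pn0 : port_numbering G) (r : G).
Local Notation config := (config A k G).

Section OneNumbering.
Variable x : relabelling G.
Local Notation pn := (relabel pn0 x).

Definition reindex_arcs (p : arc G -> arc G) (c : config) : config :=
  (memory c, [ffun a => emission c (p a)], [ffun a => reception c (p a)]).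

Definition to_ref := reindex_arcs (val x).
Definition of_ref := reindex_arcs (val x)^-1%g.

Lemma to_refK : cancel to_ref of_ref.
Proof.
move=> [[m e] c]; congr (_, _, _); apply/ffunP=> a;
by rewrite !ffunE permKV.
Qed.

Lemma of_refK : cancel of_ref to_ref.
Proof.
move=> [[m e] c]; congr (_, _, _); apply/ffunP=> a;
by rewrite !ffunE permK.
Qed.

Lemma of_ref_bij : bijective of_ref.
Proof. by exists to_ref; [exact: of_refK | exact: to_refK]. Qed.

Lemma local_view_ref c u : local_view pn c u = local_view pn0 (to_ref c) u.
Proof.
congr (_, _, _); apply/ffunP=> p; rewrite !ffunE;
by rewrite port_arc_relabel.
Qed.

(** The port wired to port [a] under [x], both named in the reference basis. *)
Definition exchange (a : arc G) : arc G := (val x)^-1%g (rev_arc (val x a)).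

Lemma exchangeK : involutive exchange.
Proof. by move=> a; rewrite /exchange permKV rev_arcK permK. Qed.

Lemma to_ref_send c : to_ref (send_config (of_ref c)) = swap_along exchange c.
Proof. by congr (_, _, _); apply/ffunP=> a; rewrite !ffunE. Qed.

Definition ref_state (s : seeds A k G) (t : nat) : state A k G :=
  [ffun c => state_after pn r s t (of_ref c)].

(** The numbering here is [pn0] for every [x]: in the common basis all runs apply the same local
    operator and differ only through [exchange]. *)
Definition ref_local (s : seeds A k G) (t : nat) : state A k G :=
  apply_local pn0 r t (ref_state s t).

Lemma ref_localE s t c :
  ref_local s t c = apply_local pn r t (state_after pn r s t) (of_ref c).
Proof.
rewrite !ffunE [RHS](reindex of_ref) /=; last exact/onW_bij/of_ref_bij.
apply: eq_bigr => c' _; rewrite ffunE; congr (_ * _).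
by apply: eq_bigr => u _; rewrite !local_view_ref !of_refK.
Qed.

(** All registers start empty, so runs with the same seeds start from the same state whatever [x]
    is. *)
Lemma ref_state0 s : ref_state s 0 = [ffun c => (c == init_config r s)%:R].
Proof.
apply/ffunP=> c; rewrite !ffunE -(inj_eq (can_inj to_refK)) of_refK.
congr (_ == _)%:R; rewrite /to_ref.
by congr (_, _, _); apply/ffunP=> a; rewrite !ffunE.
Qed.

Lemma ref_stateS s t :
  ref_state s t.+1 = [ffun c => ref_local s t (swap_along exchange c)].
Proof.
apply/ffunP=> c; rewrite [RHS]ffunE ref_localE ffunE /= ffunE.
by rewrite -to_ref_send to_refK.
Qed.

Lemma dot_swap (p : arc G -> arc G) (f g : state A k G) : involutive p ->
  dot [ffun c => f (swap_along p c)] [ffun c => g (swap_along p c)] = dot f g.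
Proof.
move=> pK; rewrite /dot [RHS](reindex (swap_along p)).
  by apply: eq_bigr => c _; rewrite !ffunE.
by apply: onW_bij; exists (swap_along p); exact: swap_alongK.
Qed.

Lemma dot_init s : dot (ref_state s 0) (ref_state s 0) = 1.
Proof.
rewrite ref_state0 dotE (bigD1 (init_config r s)) //= big1 ?addr0.
  by rewrite !ffunE eqxx /= mulr0 mulr1 addr0.
by move=> c /negbTE ne; rewrite !ffunE ne /= !mulr0 addr0.
Qed.

Lemma ref_state_unit s t : dot (ref_state s t) (ref_state s t) = 1.
Proof.
elim: t => [|t IH]; first exact: dot_init.
by rewrite ref_stateS (dot_swap _ _ exchangeK) apply_local_dot.
Qed.

Lemma ref_local_unit s t : dot (ref_local s t) (ref_local s t) = 1.
Proof. by rewrite apply_local_dot ref_state_unit. Qed.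

Lemma num_messages_ref c : num_messages (of_ref c) = num_messages c.
Proof.
have E (P Q : pred (arc G)) : (forall a, P a = Q ((val x)^-1%g a)) ->
    #|[pred a | P a]| = #|[pred a | Q a]|.
  move=> h; rewrite -!sum1_card [RHS](reindex_perm (val x)^-1%g).
  by apply: eq_bigl => a; rewrite !inE h.
by congr addn; apply: E => a; rewrite ffunE.
Qed.

Lemma ref_occupation s t :
  \sum_a occupation (ref_local s t) a <= (round_messages A k pn r t)%:R.
Proof.
apply: sum_occupation; first exact: ref_local_unit.
move=> c; rewrite ref_localE -num_messages_ref => nz.
apply: leq_trans (leq_bigmax_cond s _) => //.
exact: (leq_bigmax_cond (F := fun c => num_messages c) (of_ref c) nz).
Qed.

(** A configuration yields the same sets of ports for every [x]; only their reading as edges depends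
    on [x]. *)
Definition ref_correct (c : config) : bool :=
  `[< bfs_output pn r (config_output pn0 r c) >].

Lemma success_prob_ref :
  success_prob A k pn r =
  (\sum_(s : seeds A k G) \sum_(c | ref_correct c)
     prob (ref_state s (rounds A k)) c) / #|{: seeds A k G}|%:R.
Proof.
congr (_ / _); apply: eq_bigr => s _.
rewrite [LHS](reindex of_ref) /=; last exact/onW_bij/of_ref_bij.
apply: eq_big => c; last by rewrite /prob ffunE.
rewrite /ref_correct; congr (`[< bfs_output _ _ _ >]).
apply: functional_extensionality_dep => u.
by rewrite /config_output local_view_ref of_refK.
Qed.

End OneNumbering.
End ReferenceRun.

(** * The hard network *)

Section HardGraph.
Variables (n d : nat).
Hypotheses (d_gt0 : (0 < d)%N) (d_le : (d <= n.+1)%N).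

Local Notation I := 'I_n.+1.
Local Notation pos := (bool * I)%type.
Local Notation vertex := (option (bool * pos)).

(* The sum is taken modulo [n.+1]. *)
Definition near (i j : I) : bool := (val (i + j)%R < d)%N.

Lemma near_sym i j : near i j = near j i.
Proof. by rewrite /near addrC. Qed.

(** Translation by [i] carries the indices near [i] onto the residues below [d]. *)
Lemma card_near i : #|[set j | near i j]| = d.
Proof.
rewrite -(card_imset _ (addrI i)).
have -> : [set (i + j)%R | j in [set j | near i j]] = [set widen_ord d_le y | y in 'I_d].
  apply/setP=> y; apply/imsetP/imsetP => [[j]|[z _ ->]].
    rewrite inE => lt_d ->; exists (Ordinal lt_d) => //; exact: val_inj.
  exists (widen_ord d_le z - i)%R; last by rewrite addrC subrK.
  by rewrite inE /near addrC subrK; exact: (ltn_ord z).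
rewrite card_imset ?card_ord // => y z E; apply: val_inj.
by have := congr1 val E.
Qed.

(** [None] is the root; in [Some (s, (b, i))] the bit [s] marks the upper layer and [b] a side of a
    bipartition of that layer. Joining opposite sides only avoids loops, as [near i i] may hold. *)
Definition hard_adj (x y : vertex) : bool :=
  match x, y with
  | None, Some (s, _) => s
  | Some (s, _), None => s
  | Some (s, e), Some (s', e') =>
      if s == s' then (e.1 != e'.1) && near e.2 e'.2 else e == e'
  | None, None => false
  end.

Lemma hard_adj_sym : symmetric hard_adj.
Proof.
move=> [[s e]|] [[s' e']|] //=.
by rewrite eq_sym near_sym (eq_sym e.1) (eq_sym e).
Qed.

Lemma hard_adj_irr : irreflexive hard_adj.
Proof. by move=> [[s e]|] //=; rewrite !eqxx. Qed.

Lemma hard_connect_root v : connect hard_adj None v.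
Proof.
case: v => [[s e]|]; last exact: connect0.
have h : connect hard_adj None (Some (true, e)) by exact: connect1.
case: s => //; apply: connect_trans h _; apply: connect1 => /=.
exact: eqxx.
Qed.

Lemma hard_adj_connected u v : connect hard_adj u v.
Proof.
apply: connect_trans (hard_connect_root v).
by rewrite (sym_connect_sym hard_adj_sym) hard_connect_root.
Qed.

Definition hard_network := Network hard_adj_sym hard_adj_irr hard_adj_connected.
Local Notation G := hard_network.

Definition source : G := None.
Definition upper (e : pos) : G := Some (true, e).
Definition lower (e : pos) : G := Some (false, e).

Lemma eq_upper e e' : (upper e == upper e') = (e == e'). Proof. by []. Qed.
Lemma eq_lower e e' : (lower e == lower e') = (e == e'). Proof. by []. Qed.
Lemma upper_lower e e' : (upper e == lower e') = false. Proof. by []. Qed.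
Lemma lower_upper e e' : (lower e == upper e') = false. Proof. by []. Qed.

(** A lower vertex is at distance 2 from the root, and the only path of that length goes through the
    upper end of its spoke. *)
Lemma bfs_tree_lower (T : rel G) e : bfs_tree source T ->
  T source (upper e) /\ T (upper e) (lower e).
Proof.
case=> _ sT _ _ /(_ (lower e))[p [pT lp]].
move=> /(_ [:: upper e; lower e]); rewrite /= eqxx => /(_ isT erefl).
case: p pT lp => [//|x [|y [|//]]] /=.
  by move=> /andP[/sT] /= + _ E; rewrite E.
move=> /and3P[T0x Txy _] Ey _; rewrite {}Ey in Txy.
have := sT _ _ T0x; have := sT _ _ Txy.
case: x T0x Txy => [[[] e']|] //= T0x Txy /eqP E _.
by rewrite E in T0x Txy; split.
Qed.

(** With the two spokes and the two edges at the root, such an edge would close a cycle of length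
    5. *)
Lemma bfs_tree_no_sibling (T : rel G) e e' : bfs_tree source T ->
  T (lower e) (lower e') = false.
Proof.
move=> bT; have [T1 T2] := bfs_tree_lower e bT.
have [T3 T4] := bfs_tree_lower e' bT.
have [sym sT _ acyc _] := bT; apply/negP => T5.
have ne : e != e'.
  by apply: contraTneq (sT _ _ T5) => ->; rewrite /= eqxx.
have /acyc := isT : (2 < size [:: source; upper e; lower e; lower e'; upper e'])%N.
rewrite /= T1 T2 T5 (sym (lower e')) T4 (sym (upper e')) T3 => /(_ isT).
by rewrite !inE !eq_upper !eq_lower !upper_lower !lower_upper (negbTE ne).
Qed.

Lemma card_hard : #|G| = (4 * n.+1).+1.
Proof. by rewrite card_option !card_prod !card_bool card_ord mulnA. Qed.

(** The edges inside the upper layer suffice: each ordered pair of near indices gives one edge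
    between its two sides. *)
Lemma hard_edges_ge : (n.+1 * d <= #|edges G|)%N.
Proof.
pose S := [set ij : I * I | near ij.1 ij.2].
pose f (ij : I * I) : {set G} := [set upper (false, ij.1); upper (true, ij.2)].
have cS : #|S| = (n.+1 * d)%N.
  rewrite -sum1_card (eq_bigl (fun ij => near ij.1 ij.2)); last by move=> ij; rewrite inE.
  rewrite -(pair_big_dep xpredT (fun i j => near i j) (fun _ _ => 1%N)) /=.
  rewrite (eq_bigr (fun=> d)); last by move=> i _; rewrite sum1_card -[RHS](card_near i) cardsE.
  by rewrite sum_nat_const card_ord.
rewrite -cS -(card_in_imset (f := f)); last first.
  move=> [i j] [i' j'] _ _ E.
  have /set2P[//|[->]] : upper (true, j) \in f (i', j') by rewrite -E set22.
  by have /set2P[[->]|//] : upper (false, i) \in f (i', j') by rewrite -E set21.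
apply: subset_leq_card; apply/subsetP=> s /imsetP[[i j]]; rewrite inE /= => nij ->.
apply/imsetP; exists (upper (false, i), upper (true, j)) => //.
by rewrite inE.
Qed.

Lemma deg_hard (u : G) : (deg u <= if u is Some _ then d + 2 else 2 * n.+1)%N.
Proof.
case: u => [[s e]|].
  pose D : {set G} := [set Some (s, (~~ e.1, j)) | j in [set j | near e.2 j]].
  apply: (@leq_trans #|D :|: [set Some (~~ s, e); None]|).
    rewrite -cardsE; apply: subset_leq_card; apply/subsetP=> -[[s' e']|]; last first.
      by rewrite !inE !orbT.
    rewrite !inE /=; have [<-|ne] := eqVneq s s'.
      move=> /andP[ne near_e]; apply/orP; left; apply/imsetP; exists e'.2.
        by rewrite inE.
      congr (Some (_, _)); rewrite [LHS]surjective_pairing; congr (_, _).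
      by move: ne; case: (e.1) (e'.1) => [] [].
    move=> /eqP <-; apply/orP; right; rewrite orbF; apply/eqP; congr (Some (_, _)).
    by move: ne; case: (s) (s') => [] [].
  apply: leq_trans (leq_card_setU _ _) _; rewrite leq_add ?cards2 //.
  by apply: leq_trans (leq_imset_card _ _) _; rewrite card_near.
pose D : {set G} := [set upper e | e : pos].
apply: (@leq_trans #|D|).
  rewrite -cardsE; apply: subset_leq_card; apply/subsetP=> -[[s' e']|] //.
  by rewrite !inE => sT; apply/imsetP; exists e' => //; case: s' sT.
by apply: leq_trans (leq_imset_card _ _) _; rewrite card_prod card_bool card_ord.
Qed.

Lemma hard_edges_le : (#|edges G| <= 14 * (n.+1 * d))%N.
Proof.
apply: leq_trans (leq_imset_card _ _) _.
have -> : #|[set a : G * G | adj a.1 a.2]| = (\sum_(u : G) deg u)%N.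
  rewrite cardsE -sum1_card -(pair_big_dep xpredT (fun u v : G => adj u v) (fun _ _ => 1%N)) /=.
  by apply: eq_bigr => u _; rewrite sum1_card.
apply: (@leq_trans (\sum_(u : G) if u is Some _ then d + 2 else 2 * n.+1)%N).
  by apply: leq_sum => u _; exact: deg_hard.
rewrite (bigD1 (None : G)) //=.
rewrite (eq_bigr (fun _ => d + 2)%N); last by case.
rewrite sum_nat_const.
have -> : #|[pred i : G | i != None]| = (4 * n.+1)%N.
  have := cardC1 (None : G); rewrite card_hard /= => <-.
  by apply: eq_card => u; rewrite !inE.
(* With [N = n.+1] the degrees add up to at most [2N + 4N(d + 2) = N(4d + 10)], which is at most
   [14Nd] since [d] is positive. *)
nia.
Qed.

End HardGraph.

(** * Moves *)

Section Moves.
Variables (n d : nat).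
Hypotheses (d_le : (d <= n.+1)%N).

Local Notation I := 'I_n.+1.
Local Notation pos := (bool * I)%type.
Local Notation G := (hard_network n d).
Local Notation up := (@upper n d).
Local Notation lo := (@lower n d).

(** A spoke with the index of a sibling of its upper end and of one of its lower end; the side of
    both siblings is forced. *)
Definition move := {g : pos * (I * I) |
  near d g.1.2 g.2.1 && near d g.1.2 g.2.2}.

Implicit Types (g : move) (x : relabelling G) (a : arc G).

Definition spoke_of (g : move) : pos := (val g).1.
Definition sibling_up (g : move) : pos := (~~ (spoke_of g).1, (val g).2.1).
Definition sibling_lo (g : move) : pos := (~~ (spoke_of g).1, (val g).2.2).

Lemma spoke_adj (e : pos) : adj (up e : G) (lo e).
Proof. exact: eqxx. Qed.

Lemma sibling_up_adj g : adj (up (spoke_of g) : G) (up (sibling_up g)).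
Proof.
have /andP[h _] := valP g; apply/andP; split; last exact: h.
by rewrite /= ; case: (spoke_of g).1.
Qed.

Lemma sibling_lo_adj g : adj (lo (spoke_of g) : G) (lo (sibling_lo g)).
Proof.
have /andP[_ h] := valP g; apply/andP; split; last exact: h.
by rewrite /= ; case: (spoke_of g).1.
Qed.

Definition mk_arc (u v : G) (h : adj u v) : arc G :=
  exist (fun a : G * G => adj a.1 a.2) (u, v) h.

Definition down_arc (g : move) : arc G := mk_arc (spoke_adj (spoke_of g)).
Definition up_arc (g : move) : arc G := rev_arc (down_arc g).
Definition upper_arc (g : move) : arc G := mk_arc (sibling_up_adj g).
Definition lower_arc (g : move) : arc G := mk_arc (sibling_lo_adj g).

Definition move_perm (g : move) : {perm arc G} :=
  (tperm (down_arc g) (upper_arc g) * tperm (up_arc g) (lower_arc g))%g.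

(** The arcs along spokes, in either direction. *)
Definition special (a : arc G) : bool :=
  match (val a).1, (val a).2 with
  | Some (s, _), Some (s', _) => s != s'
  | _, _ => false
  end.

Lemma special_rev a : special (rev_arc a) = special a.
Proof.
rewrite /special /=; case: (val a).1 (val a).2 => [[s e]|] [[s' e']|] //=.
by rewrite eq_sym.
Qed.

Lemma special_down g : special (down_arc g). Proof. by []. Qed.
Lemma special_up g : special (up_arc g). Proof. by []. Qed.
Lemma special_upper g : special (upper_arc g) = false. Proof. by []. Qed.
Lemma special_lower g : special (lower_arc g) = false. Proof. by []. Qed.

Lemma move_perm_down g : move_perm g (down_arc g) = upper_arc g.
Proof. by rewrite permM tpermL tpermD. Qed.

Lemma move_perm_upper g : move_perm g (upper_arc g) = down_arc g.
Proof. by rewrite permM tpermR tpermD. Qed.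

Lemma move_perm_up g : move_perm g (up_arc g) = lower_arc g.
Proof. by rewrite permM [X in tperm _ _ X]tpermD // tpermL. Qed.

Lemma move_perm_lower g : move_perm g (lower_arc g) = up_arc g.
Proof. by rewrite permM [X in tperm _ _ X]tpermD // tpermR. Qed.

Lemma move_perm_id g a :
  a \notin [:: down_arc g; upper_arc g; up_arc g; lower_arc g] -> move_perm g a = a.
Proof.
rewrite !inE !negb_or => /and4P[h1 h2 h3 h4].
by rewrite permM !tpermD // eq_sym.
Qed.

Lemma move_permE g a : move_perm g a != a ->
  [\/ a = down_arc g, a = upper_arc g, a = up_arc g | a = lower_arc g].
Proof.
move=> ne; have : a \in [:: down_arc g; upper_arc g; up_arc g; lower_arc g].
  by apply: contraR ne => /move_perm_id ->.
rewrite !inE => /or4P[] /eqP ->.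
- by constructor 1.
- by constructor 2.
- by constructor 3.
- by constructor 4.
Qed.

Lemma move_permK g : involutive (move_perm g).
Proof.
move=> a; have [ha|] := eqVneq (move_perm g a) a; first by rewrite !ha.
by case/move_permE => ->; rewrite ?(move_perm_down, move_perm_upper, move_perm_up, move_perm_lower).
Qed.

Lemma move_perm_source g a : (val (move_perm g a)).1 = (val a).1.
Proof.
have [->//|] := eqVneq (move_perm g a) a.
by case/move_permE => ->; rewrite ?(move_perm_down, move_perm_upper, move_perm_up, move_perm_lower).
Qed.

Lemma move_ports_source (x : relabelling G) g : source_preserving (val x * move_perm g)%g.
Proof.
by apply/forallP=> a; rewrite permM move_perm_source relabelling_source.
Qed.

Definition move_ports (x : relabelling G) (g : move) : relabelling G :=
  exist _ (val x * move_perm g)%g (move_ports_source x g).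

Lemma move_portsE x g a : val (move_ports x g) a = move_perm g (val x a).
Proof. exact: permM. Qed.

Lemma move_portsK g : involutive (move_ports^~ g).
Proof. by move=> x; apply/val_inj/permP=> a; rewrite !move_portsE move_permK. Qed.

(** Rewiring affects a port as soon as the edge it holds is re-plugged at either end. *)
Definition moved g a := (move_perm g a != a) || (move_perm g (rev_arc a) != rev_arc a).

Lemma exchange_move_portsE x g a :
  val x (exchange (move_ports x g) a) = move_perm g (rev_arc (move_perm g (val x a))).
Proof.
rewrite /exchange; set b := rev_arc _.
apply: (can_inj (move_permK g)); rewrite -move_portsE permKV move_permK.
by rewrite /b move_portsE.
Qed.

Lemma exchange_moved x g a :
  exchange x a != exchange (move_ports x g) a -> moved g (val x a).
Proof.
apply: contraR; rewrite negb_or !negbK => /andP[/eqP h1 /eqP h2].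
apply/eqP; apply: (@perm_inj _ (val x)); rewrite exchange_move_portsE h1 h2.
by rewrite /exchange permKV.
Qed.

Lemma moved_special g a : moved g a -> special a -> a = down_arc g \/ a = up_arc g.
Proof.
case/orP=> /move_permE[] E.
- by left.
- by rewrite E special_upper.
- by right.
- by rewrite E special_lower.
- by move=> _; right; rewrite -[a]rev_arcK E.
- by rewrite -special_rev E special_upper.
- by move=> _; left; rewrite -[a]rev_arcK E rev_arcK.
- by rewrite -special_rev E special_lower.
Qed.

Lemma moved_nonspecial g a : moved g a -> ~~ special a ->
  [\/ a = upper_arc g, a = lower_arc g, rev_arc a = upper_arc g | rev_arc a = lower_arc g].
Proof.
case/orP=> /move_permE[] E.
- by rewrite E special_down.
- by constructor 1.
- by rewrite E special_up.
- by constructor 2.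
- by rewrite -special_rev E special_down.
- by constructor 3.
- by rewrite -special_rev E special_up.
- by constructor 4.
Qed.

(** Concerns a port holding a spoke and the port at the other end of it: after the move both hold
    sibling edges. This rules out drops pairing two spokes. *)
Lemma move_not_special g a : moved g a -> special a ->
  ~~ special (move_perm g a) /\ ~~ special (move_perm g (rev_arc a)).
Proof.
move=> ma sa; case: (moved_special ma sa) => ->.
  by rewrite move_perm_down -/(up_arc g) move_perm_up special_upper special_lower.
by rewrite {2}/up_arc rev_arcK move_perm_down move_perm_up special_upper special_lower.
Qed.

(** Once the spoke and one sibling are fixed, only the other sibling is free, among [d] near
    indices. *)
Lemma card_fiber (S : {set move}) (f : move -> I) :
  {in S &, forall g g', spoke_of g = spoke_of g'} ->
  {in S &, injective f} ->
  (forall g, near d (spoke_of g).2 (f g)) -> (#|S| <= d)%N.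
Proof.
move=> eqS injf nf; have [->|[g0 g0S]] := set_0Vmem S; first by rewrite cards0.
rewrite -(card_in_imset injf); apply: leq_trans (eq_leq (card_near d_le (spoke_of g0).2)).
apply: subset_leq_card; apply/subsetP=> j /imsetP[g gS ->].
by rewrite inE -(eqS g g0 gS g0S).
Qed.

Lemma move_inj g g' : spoke_of g = spoke_of g' ->
  (val g).2.1 = (val g').2.1 -> (val g).2.2 = (val g').2.2 -> g = g'.
Proof.
move=> h1 h2 h3; apply: val_inj.
by rewrite [LHS]surjective_pairing [RHS]surjective_pairing -/(spoke_of g) h1
  [(val g).2]surjective_pairing h2 h3 -surjective_pairing.
Qed.

Lemma card_upper a : (#|[set g | upper_arc g == a]| <= d)%N.
Proof.
have E g g' : upper_arc g = upper_arc g' -> spoke_of g = spoke_of g' /\ (val g).2.1 = (val g').2.1.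
  by move=> /(congr1 val) [].
apply: (@card_fiber _ (fun g => (val g).2.2)).
- by move=> g g'; rewrite !inE => /eqP <- /eqP /esym/E[].
- by move=> g g'; rewrite !inE => /eqP <- /eqP /esym/E[h1 h2] h3; apply: move_inj.
- by move=> g; have /andP[] := valP g.
Qed.

Lemma card_lower a : (#|[set g | lower_arc g == a]| <= d)%N.
Proof.
have E g g' : lower_arc g = lower_arc g' -> spoke_of g = spoke_of g' /\ (val g).2.2 = (val g').2.2.
  by move=> /(congr1 val) [].
apply: (@card_fiber _ (fun g => (val g).2.1)).
- by move=> g g'; rewrite !inE => /eqP <- /eqP /esym/E[].
- by move=> g g'; rewrite !inE => /eqP <- /eqP /esym/E[h1 h2] h3; apply: move_inj.
- by move=> g; have /andP[] := valP g.
Qed.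

Lemma card_moved_nonspecial a : ~~ special a -> (#|[set g | moved g a]| <= 4 * d)%N.
Proof.
move=> sa.
apply: (@leq_trans #|([set g | upper_arc g == a] :|: [set g | lower_arc g == a]) :|:
  ([set g | upper_arc g == rev_arc a] :|: [set g | lower_arc g == rev_arc a])|).
  apply: subset_leq_card; apply/subsetP=> g; rewrite !inE => /moved_nonspecial.
  by case/(_ sa) => ->; rewrite eqxx ?orbT.
rewrite (_ : 4 * d = (d + d) + (d + d))%N; last by lia.
apply: leq_trans (leq_card_setU _ _) (leq_add _ _);
apply: leq_trans (leq_card_setU _ _) (leq_add _ _); rewrite ?card_upper ?card_lower //.
Qed.

Lemma card_moves_at (e : pos) : #|[set g : move | spoke_of g == e]| = (d * d)%N.
Proof.
transitivity #|setX [set j | near d e.2 j] [set j | near d e.2 j]|; last first.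
  by rewrite cardsX !(card_near d_le).
rewrite -(card_in_imset (f := fun g : move => (val g).2)); last first.
  move=> g g'; rewrite !inE => /eqP E /eqP E' E2; apply: move_inj; rewrite ?E2 //.
  by rewrite E E'.
congr #|pred_of_set _|; apply/setP=> -[j j']; rewrite !inE /=.
apply/imsetP/idP => [[g]|h].
  by rewrite inE => /eqP <- /= E; have := valP g; rewrite -E.
by exists (exist _ (e, (j, j')) h) => //; rewrite inE.
Qed.

(** A spoke arc is affected only by the moves of its own spoke. *)
Lemma card_moved_special a : special a -> (#|[set g | moved g a]| <= d * d)%N.
Proof.
move=> sa; have [->|[g0]] := set_0Vmem [set g | moved g a]; first by rewrite cards0.
rewrite inE => m0; rewrite -(card_moves_at (spoke_of g0)).
apply: subset_leq_card; apply/subsetP=> g; rewrite !inE => m.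
have : down_arc g = down_arc g0.
  case: (moved_special m sa) (moved_special m0 sa) => -> [] //.
  by move/(can_inj (@rev_arcK G)).
by move/(congr1 val) => -[-> _].
Qed.

Lemma card_move : #|{: move}| = (2 * n.+1 * (d * d))%N.
Proof.
rewrite -sum1_card (partition_big spoke_of xpredT) //=.
rewrite (eq_bigr (fun=> d * d)%N).
  by rewrite sum_nat_const card_prod card_bool card_ord.
by move=> e _; rewrite sum1_card -[RHS](card_moves_at e) cardsE.
Qed.

Section Correct.
Variables (R : realType) (A : algorithm R) (k : nat) (pn0 : port_numbering G).

(** The port at the lower end of the spoke tells the outputs apart: before the move it must be
    output, and after it leads to a lower sibling and must not be. *)
Lemma correct_disjoint (x : relabelling G) g (c : config A k G) :
  ref_correct pn0 (source n d) x c -> ~~ ref_correct pn0 (source n d) (move_ports x g) c.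
Proof.
move=> /asboolP[T1 bT1 O1]; apply/asboolP => -[T2 bT2 O2].
have [p /eqP Ep] := port_surj (relabel pn0 x) (valP (up_arc g)).
have Ea : val x (port_arc pn0 p) = up_arc g.
  apply: val_inj; rewrite relabel_arcE; congr (_, _); exact: Ep.
have Ep2 : port (relabel pn0 (move_ports x g)) p = lo (sibling_lo g).
  by rewrite /= move_portsE Ea move_perm_up.
have := O1 _ p; rewrite Ep; have := O2 _ p; rewrite Ep2 => ->.
rewrite /= (bfs_tree_no_sibling _ _ bT2).
have [sym _ _ _ _] := bT1; rewrite sym.
by have [_ ->] := bfs_tree_lower (spoke_of g) bT1.
Qed.

End Correct.
End Moves.

(** * The adversary bound *)

Section DefaultNumbering.
Variable G : network.

Definition default_port (u : G) (p : 'I_(deg u)) : G := enum_val p.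

Lemma default_port_adj (u : G) (p : 'I_(deg u)) : adj u (default_port p).
Proof. by have := enum_valP p; rewrite inE. Qed.

Definition default_numbering : port_numbering G :=
  PortNumbering default_port_adj (fun u => @enum_val_inj G [pred v | adj u v]).

End DefaultNumbering.

(* Linear in the success probabilities, so that it can be averaged over the
   seeds; the best [delta] would give the usual [2 sqrt (eps (1 - eps))]. *)
Lemma dot_disjoint_le (R : realType) (A : algorithm R) (k : nat) (G : network)
    (f g : state A k G) (P Q : pred (config A k G)) (delta : R) :
  0 < delta <= 1 -> (forall c, P c -> ~~ Q c) ->
  dot f g <= delta / 2 * (\sum_(c | P c) prob f c + \sum_(c | Q c) prob g c)
    + delta^-1 / 2 * (dot f f - \sum_(c | P c) prob f c
                      + (dot g g - \sum_(c | Q c) prob g c)).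
Proof.
move=> /andP[d_gt0 d_le1] PQ.
have splitE (h : state A k G) (S : pred (config A k G)) :
    dot h h - \sum_(c | S c) prob h c = \sum_(c | ~~ S c) prob h c.
  by rewrite dot_prob (bigID S) /= addrC addrK.
rewrite !splitE !(big_mkcond P) !(big_mkcond Q).
rewrite (big_mkcond (fun c => ~~ P c)) (big_mkcond (fun c => ~~ Q c)) /=.
rewrite -!big_split !mulr_sumr -big_split; apply: ler_sum => c _ /=.
have dV : delta * delta^-1 = 1 by rewrite divff ?gt_eqF.
have dV1 : 1 <= delta^-1 by rewrite invr_ge1 ?unitfE ?gt_eqF.
have pf := prob_ge0 f c; have pg := prob_ge0 g c.
(* [H1], [H2] and [H3] serve the configurations in [P], in [Q] only, and in neither; [delta] is the
   coefficient of the state that is correct there. *)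
have H1 : complex.Re ((f c)^* * g c) <= (delta * prob f c + delta^-1 * prob g c) / 2.
  by apply: le_trans (ler_norm _) (mulr_ge1_amgm _ _ d_gt0 _); rewrite dV.
have H2 : complex.Re ((f c)^* * g c) <= (delta^-1 * prob f c + delta * prob g c) / 2.
  apply: le_trans (ler_norm _) (mulr_ge1_amgm _ _ _ _); first by rewrite invr_gt0.
  by rewrite mulrC dV.
have H3 : complex.Re ((f c)^* * g c) <= (delta^-1 * prob f c + delta^-1 * prob g c) / 2.
  apply: le_trans H1 _; rewrite ler_pM2r ?invr_gt0 // lerD2r ler_wpM2r //.
  exact: le_trans dV1.
case: (boolP (P c)) (boolP (Q c)) => [/PQ /negbTE -> _ | _ [_|_]] /=; lra.
Qed.

(** * Total overlap of runs over all numberings and moves *)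

Section Adversary.
Variables (R : realType) (A : algorithm R) (k n d : nat).
Hypotheses (d_gt0 : (0 < d)%N) (d_le : (d <= n.+1)%N).
Local Notation G := (hard_network n d).
Local Notation r := (source n d).
Local Notation pn0 := (default_numbering G).
Local Notation X := (relabelling G).
Local Notation q := (Num.sqrt (d%:R : R)).
Implicit Types (x : X) (g : move n d) (a : arc G) (s : seeds A k G).

(** The exponents balance the two kinds of ports: [d^2 / q] and [d * q] agree because [q^2 = d]. *)
Definition weight (a : arc G) : R := if special a then q^-1 else q.

Let q_ge1 : 1 <= q.
Proof. by rewrite -[X in X <= _]sqrtr1 ler_wsqrtr ?ler1n. Qed.

Let q_gt0 : 0 < q. Proof. exact: lt_le_trans q_ge1. Qed.

Let qq : q * q = d%:R.
Proof. by rewrite -expr2 sqr_sqrtr ?ler0n. Qed.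

Lemma weight_gt0 a : 0 < weight a.
Proof. by rewrite /weight; case: ifP; rewrite ?invr_gt0. Qed.

Lemma weight_mul_ge1 a b : ~~ (special a && special b) -> 1 <= weight a * weight b.
Proof.
rewrite /weight; case: (special a); case: (special b) => // _.
- by rewrite mulVf // gt_eqF.
- by rewrite divff // gt_eqF.
- by rewrite qq ler1n.
Qed.

Definition overlap s t x g : R :=
  dot (ref_state pn0 r x s t) (ref_state pn0 r (move_ports x g) s t).

Definition drop_bound s t x g : R :=
  \sum_(a | exchange x a != exchange (move_ports x g) a)
    (weight (val x a) * occupation (ref_local pn0 r x s t) a
     + weight (val (move_ports x g) a) * occupation (ref_local pn0 r (move_ports x g) s t) a).

Lemma overlap_drop s t x g :
  overlap s t x g - overlap s t.+1 x g <= drop_bound s t x g.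
Proof.
rewrite /overlap !ref_stateS -(apply_local_dot pn0 r t).
apply: swap_along_dot => [||a|a|a ne|a ne].
- exact: exchangeK.
- exact: exchangeK.
- exact: weight_gt0.
- exact: weight_gt0.
- apply: weight_mul_ge1; rewrite move_portsE; apply/negP => /andP[sp].
  by have [/negbTE -> _] := move_not_special (exchange_moved ne) sp.
- apply: weight_mul_ge1; apply/negP => /andP[sp].
  rewrite {1}/exchange permKV move_portsE special_rev {1}/exchange permKV.
  by have [_ /negbTE ->] := move_not_special (exchange_moved ne) sp.
Qed.

Lemma sum_drop_bound s t :
  \sum_x \sum_g drop_bound s t x g <=
  8 * d%:R * q * \sum_x (round_messages A k (relabel pn0 x) r t)%:R.
Proof.
pose W x g := \sum_(a | exchange x a != exchange (move_ports x g) a)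
    weight (val x a) * occupation (ref_local pn0 r x s t) a.
(* For each [g] the map [move_ports^~ g] is an involution, so the two halves of the drop have the
   same total. *)
have -> : \sum_x \sum_g drop_bound s t x g = 2 * \sum_x \sum_g W x g.
  have -> : \sum_x \sum_g drop_bound s t x g =
      \sum_x \sum_g W x g + \sum_x \sum_g W (move_ports x g) g.
    rewrite -big_split; apply: eq_bigr => x _; rewrite -big_split; apply: eq_bigr => g _.
    rewrite /drop_bound big_split; congr (_ + _); apply: eq_bigl => a.
    by rewrite move_portsK eq_sym.
  rewrite mulr_natl mulr2n; congr (_ + _); rewrite exchange_big [RHS]exchange_big.
  apply: eq_bigr => g _; rewrite [RHS](reindex (fun x => move_ports x g)) //.
  by apply: onW_bij; exists (fun x => move_ports x g); exact: move_portsK.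
rewrite !mulr_sumr; apply: ler_sum => x _.
have W_le : \sum_g W x g <= 4 * d%:R * q * \sum_a occupation (ref_local pn0 r x s t) a.
  rewrite /W (exchange_big_dep xpredT) //= mulr_sumr; apply: ler_sum => a _.
  have o_ge0 := occupation_ge0 (ref_local pn0 r x s t) a.
  rewrite sumr_const -[X in X <= _]mulr_natl mulrA ler_wpM2r //.
  apply: (@le_trans _ _ (#|[set g | moved g (val x a)]|%:R * weight (val x a))).
    apply: ler_wpM2r; first exact/ltW/weight_gt0.
    rewrite ler_nat; apply: subset_leq_card; apply/subsetP => g.
    by rewrite inE; exact: exchange_moved.
  (* Spokes give [d^2 / q = d * q], other arcs [4 * d * q]; the larger bound serves both. *)
  rewrite /weight; case: ifPn => sp.
    have := card_moved_special d_le sp; rewrite -(ler_nat R) natrM => h.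
    rewrite ler_pdivrMr //; apply: le_trans h _.
    rewrite -(mulrA (4 * d%:R)) qq -mulrA ler_peMl ?mulr_ge0 ?ler0n //.
    by rewrite ler1n.
  have := card_moved_nonspecial d_le sp; rewrite -(ler_nat R) natrM => h.
  by rewrite ler_wpM2r // ltW.
apply: (@le_trans _ _ (2 * (4 * d%:R * q * \sum_a occupation (ref_local pn0 r x s t) a))).
  by rewrite ler_pM2l.
rewrite !mulrA -natrM ler_wpM2l ?ref_occupation //.
by rewrite !mulr_ge0 ?ler0n // ltW.
Qed.

(** Drops telescope over the rounds; every initial overlap is 1, so the first term is the initial
    total. *)
Lemma overlap_total s :
  (#|{: X}| * #|{: move n d}|)%:R - \sum_x \sum_g overlap s (rounds A k) x g <=
  8 * d%:R * q * \sum_x (message_complexity A k (relabel pn0 x) r)%:R.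
Proof.
pose P t := \sum_x \sum_g overlap s t x g.
have P0 : P 0%N = (#|{: X}| * #|{: move n d}|)%:R.
  have o1 x g : overlap s 0 x g = 1.
    by rewrite /overlap [X in dot _ X]ref_state0 -(ref_state0 pn0 r x s) dot_init.
  rewrite /P; under eq_bigr do under eq_bigr do rewrite o1.
  by rewrite sumr_const sumr_const -mulrnA mulnC.
have step t : P t - P t.+1 <=
    8 * d%:R * q * \sum_x (round_messages A k (relabel pn0 x) r t)%:R.
  apply: le_trans (sum_drop_bound s t); rewrite /P -sumrB; apply: ler_sum => x _.
  by rewrite -sumrB; apply: ler_sum => g _; exact: overlap_drop.
have tele T : P 0%N - P T <= 8 * d%:R * q *
    \sum_x (\sum_(t < T) round_messages A k (relabel pn0 x) r t)%:R.
  elim: T => [|T IH].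
    by rewrite subrr mulr_ge0 ?mulr_ge0 ?sumr_ge0 ?ler0n // ltW.
  under eq_bigr do rewrite big_ord_recr natrD.
  by rewrite big_split mulrDr; have := step T => /=; move: IH => /=; lra.
by rewrite -P0; exact: tele.
Qed.

Variable eps : R.
Hypothesis eps_itv : 0 <= eps < 1 / 2.
Hypothesis success : forall pn : port_numbering G, 1 - eps <= success_prob A k pn r.

Lemma seeds_gt0 : 0 < #|{: seeds A k G}|%:R :> R.
Proof.
rewrite ltr0n; apply/card_gt0P.
by exists [ffun=> [tuple of nseq (rand_bits A k) false]].
Qed.

Lemma sum_correct x :
  (1 - eps) * #|{: seeds A k G}|%:R <=
  \sum_(s : seeds A k G) \sum_(c | ref_correct pn0 r x c) prob (ref_state pn0 r x s (rounds A k)) c.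
Proof.
by have := success (relabel pn0 x); rewrite success_prob_ref ler_pdivlMr ?seeds_gt0.
Qed.

Lemma final_overlap x g :
  \sum_(s : seeds A k G) overlap s (rounds A k) x g <=
  (1 / 2 + 2 * eps * (1 - eps)) * #|{: seeds A k G}|%:R.
Proof.
have /andP[e0 e1] := eps_itv.
(* Chosen so that [delta * (1 - eps) = 1 / 2] and [eps / delta = 2 * eps * (1 - eps)], the two terms
   of the claim. It stays positive at [eps = 0], and is at most 1 since [eps < 1 / 2]. *)
pose delta := (2 * (1 - eps))^-1.
have dgt0 : 0 < delta by rewrite invr_gt0; lra.
have dle1 : delta <= 1 by rewrite invf_le1; lra.
set S := #|{: seeds A k G}|%:R.
have := sum_correct x; have := sum_correct (move_ports x g).
set al := \sum_s _; set be := \sum_s _ => hal hbe.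
apply: (@le_trans _ _ (delta / 2 * (be + al) + delta^-1 / 2 * ((S - be) + (S - al)))).
  have -> : S = \sum_(s : seeds A k G) 1 by rewrite sumr_const.
  rewrite /al /be -!sumrB -!big_split !mulr_sumr -big_split /=.
  apply: ler_sum => s _.
  have := @dot_disjoint_le R A k G (ref_state pn0 r x s (rounds A k))
    (ref_state pn0 r (move_ports x g) s (rounds A k)) (ref_correct pn0 r x)
    (ref_correct pn0 r (move_ports x g)) delta.
  rewrite !ref_state_unit dgt0 dle1; apply => // c.
  exact: correct_disjoint.
have dV : delta^-1 = 2 * (1 - eps) by rewrite invrK.
have dd : delta * (1 - eps) = 1 / 2 by rewrite /delta; field; lra.
(* Hence the bound decreases in [al + be], and the worst case is equality in [hal] and [hbe]. *)
have h2 : delta <= delta^-1 by apply: (le_trans dle1); rewrite invf_ge1.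
have h3 : (delta^-1 - delta) * ((1 - eps) * S) <= (delta^-1 - delta) * ((al + be) / 2).
  by apply: ler_wpM2l; lra.
have h4 : delta * ((1 - eps) * S) = S / 2 by rewrite mulrA dd; lra.
move: h3; rewrite mulrBl h4 dV => h3.
move: h3; nra.
Qed.

Lemma exists_costly_numbering :
  exists x, (1 / 2 - 2 * eps * (1 - eps)) * (n.+1)%:R * q / 4 <=
    (message_complexity A k (relabel pn0 x) r)%:R.
Proof.
set gam := 1 / 2 - _.
apply/existsP; apply: contraT; rewrite negb_exists => /forallP small.
(* The identity relabelling shows that [X] is inhabited, which makes the summed inequality
   strict. *)
have sp1 : source_preserving (1%g : {perm arc G}) by apply/forallP=> a; rewrite perm1.
pose x0 : X := exist (fun p : {perm arc G} => source_preserving p) 1%g sp1.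
have lower_bd : gam * (#|{: X}| * #|{: move n d}|)%:R <=
    8 * d%:R * q * \sum_x (message_complexity A k (relabel pn0 x) r)%:R.
  rewrite -(ler_pM2r seeds_gt0).
  set S := #|{: seeds A k G}|; set C := 8 * _ * _ * _; set XM := (_ * _)%:R.
  have h1 : \sum_(s : seeds A k G) (XM - \sum_x \sum_g overlap s (rounds A k) x g)
      <= \sum_(s : seeds A k G) C.
    by apply: ler_sum => s _; exact: overlap_total.
  have sumC (z : R) : \sum_(s : seeds A k G) z = z * S%:R.
    by rewrite sumr_const mulr_natr.
  move: h1; rewrite sumrB !sumC => h1.
  have h2 : \sum_(s : seeds A k G) \sum_x \sum_g overlap s (rounds A k) x g <=
      (1 / 2 + 2 * eps * (1 - eps)) * S%:R * XM.
    rewrite exchange_big /=.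
    apply: (@le_trans _ _ (\sum_(x : X) \sum_(g : move n d) (1 / 2 + 2 * eps * (1 - eps)) * S%:R)).
      apply: ler_sum => x _; rewrite exchange_big; apply: ler_sum => g _.
      exact: final_overlap.
    by rewrite !sumr_const -mulrnA -[X in X <= _]mulr_natr mulnC.
  by rewrite /gam; move: h1 h2; lra.
have upper_bd : \sum_x (message_complexity A k (relabel pn0 x) r)%:R <
    gam * (n.+1)%:R * q / 4 * #|{: X}|%:R.
  rewrite mulr_natr -sumr_const; apply: ltr_sum => [|x _].
    by apply/hasP; exists x0; first exact: mem_index_enum.
  by rewrite ltNge small.
have K_gt0 : 0 < 8 * d%:R * q by rewrite !mulr_gt0 ?ltr0n.
move: upper_bd; rewrite -(ltr_pM2l K_gt0) => /(le_lt_trans lower_bd).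
(* Both sides are now equal: [8 * d * q] times [n.+1 * q / 4] is [2 * n.+1 * d^2], the number of
   moves. *)
rewrite (card_move d_le) !natrM.
have := qq; set z := Num.sqrt _ => <-.
rewrite [X in X < _](_ : _ = 8 * (z * z) * z * (gam * n.+1%:R * z / 4 * #|{: X}|%:R)).
  by rewrite ltxx.
by field.
Qed.

End Adversary.

(** * Constants of the lower bound *)

Theorem theorem7p5 (R : realType) :
  exists a1 a2 b1 b2 : R,
    [/\ 0 < a1, 0 < a2, 0 < b1 & 0 < b2] /\
    forall eps : R, 0 <= eps < 1 / 2 ->
    exists2 c : R, 0 < c &
    forall (known : nat -> nat) (A : algorithm R),
      polynomial_upper_bound known ->
      log_size_messages A known ->
      solves_bfs A known eps ->
      forall N d : nat, (0 < d)%N -> (d <= N - 1)%N ->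
      exists (G : network) (r : G) (pn : port_numbering G),
        let n := #|G| in
        let m := #|edges G| in
        [/\ a1 * N%:R <= n%:R <= a2 * N%:R,
            b1 * (N * d)%:R <= m%:R <= b2 * (N * d)%:R
          & c * Num.sqrt ((m * n)%:R) <=
              (message_complexity A (known n) pn r)%:R].
Proof.
exists 1, 5, 1, 14; split=> // eps /andP[e0 e1].
(* The left-out closed form is [2 * (1 / 2 - eps)^2]. *)
have gam_gt0 : 0 < 1 / 2 - 2 * eps * (1 - eps) by nra.
(* Here 36 is 4, from the cost of the numbering found, times 9, from
   [sqrt (m * n) <= 9 * N * sqrt d]. *)
exists ((1 / 2 - 2 * eps * (1 - eps)) / 36); first by rewrite divr_gt0.
(* For [N = 0] the truncated [N - 1] is 0, which contradicts [0 < d]; otherwise [N] is [n.+1]. *)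
move=> known A _ _ solves [|n] d d_gt0; first by rewrite leqn0 => /eqP d0; rewrite d0 in d_gt0.
rewrite subn1 /= => d_le; have d_le1 : (d <= n.+1)%N by apply: leqW.
pose G := hard_network n d.
have eps_itv : 0 <= eps < 1 / 2 by rewrite e0 e1.
have [x hx] := @exists_costly_numbering R A (known #|G|) n d d_gt0 d_le1 eps eps_itv
  (fun pn => solves G pn (source n d)).
exists G, (source n d), (relabel (default_numbering G) x).
have cG : #|G| = (4 * n.+1).+1 := card_hard n d.
have m_ge := hard_edges_ge d_le1; have m_le := hard_edges_le d_gt0 d_le1.
split.
- by rewrite cG mul1r -natrM !ler_nat; lia.
- by rewrite mul1r -natrM !ler_nat m_ge m_le.
apply: le_trans hx.
have h : Num.sqrt ((#|edges G| * #|G|)%:R : R) <= 9 * (n.+1%:R * Num.sqrt d%:R).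
  rewrite -[X in _ <= X]ger0_norm ?mulr_ge0 ?sqrtr_ge0 ?ler0n // -sqrtr_sqr.
  apply: ler_wsqrtr; rewrite !exprMn sqr_sqrtr ?ler0n // -!natrX -!natrM ler_nat.
  apply: (@leq_trans (14 * (n.+1 * d) * (5 * n.+1))%N).
    by rewrite leq_mul // cG; lia.
  rewrite (_ : 14 * (n.+1 * d) * (5 * n.+1) = 70 * (n.+1 ^ 2 * d))%N; last by ring.
  (* The 9 above comes from [70 <= 9 ^ 2]. *)
  by rewrite leq_mul2r orbT.
apply: (le_trans (ler_wpM2l _ h)); first by rewrite divr_ge0 // ltW.
by rewrite le_eqVlt; apply/orP; left; apply/eqP; field.
Qed.
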